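(* Let $\bar\mu=\|J_{\mathrm{ILS}}^{\dagger}A^{\top}\Sigma_{pq}r_y\|_2$ and $\eta_1=\sqrt{\theta^{-2}+\|y\|_2^{2}}$. If $4\,\eta_1\,\|J_{\mathrm{ILS}}^{\dagger}\|_2\,\bar\mu<1$, then $$\frac{2}{1+\sqrt 2}\,\bar\mu\;\le\;\mu\;\le\;2\bar\mu .$$
   Context: Let $m\ge n$, $p+q=m$, and $\Sigma_{pq}=\begin{pmatrix} I_p&0\\0&-I_q\end{pmatrix}$. Let $A\in\mathbb R^{m\times n}$ and $b\in\mathbb R^m$; throughout it is assumed that $A^{\top}\Sigma_{pq}A$ is positive definite. The indefinite least squares (ILS) problem is $\min_x (b-Ax)^{\top}\Sigma_{pq}(b-Ax)$. Let $y\in\mathbb R^n$ be an arbitrary vector (an approximate solution), $r_y=b-Ay$, and let $\theta>0$ be a parameter. Define $$\xi_{\mathrm{ILS}}=\{(\Delta A,\Delta b)\in\mathbb R^{m\times n}\times\mathbb R^m:\ (A+\Delta A)^{\top}\Sigma_{pq}\big(b+\Delta b-(A+\Delta A)y\big)=0\},$$ and the normwise backward error of $y$ $$\mu=\min_{(\Delta A,\Delta b)\in\xi_{\mathrm{ILS}}}\big\|[\Delta A,\ \theta\,\Delta b]\big\|_F ,$$ where $\|\cdot\|_F$ is the Frobenius norm. Define the $n\times(mn+m)$ matrix $$J_{\mathrm{ILS}}=\Big(I_n\otimes r_y^{\top}\Sigma_{pq}-A^{\top}\Sigma_{pq}(y^{\top}\otimes I_m),\ \ \theta^{-1}A^{\top}\Sigma_{pq}\Big),$$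 where $\otimes$ is the Kronecker product. $J_{\mathrm{ILS}}^{\dagger}$ is the Moore–Penrose inverse, and $\|\cdot\|_2$ is the Euclidean norm of a vector or the spectral norm of a matrix. *)

(* Defs.v *)
From mathcomp Require Import all_boot all_order all_algebra.
From mathcomp Require Import all_classical all_reals.
From mathcomp Require Export mxtens.

Set Implicit Arguments.
Unset Strict Implicit.
Unset Printing Implicit Defensive.

Import Order.TTheory GRing.Theory Num.Theory.

Local Open Scope classical_set_scope.
Local Open Scope ring_scope.

(* The norm carried by 'M[R]_(m, n) in MathComp-Analysis is the max norm, so
   the Euclidean, spectral and Frobenius norms are defined here. *)
Definition norm2 (R : realType) (n : nat) (v : 'cV[R]_n) : R :=
  Num.sqrt (\sum_i v i 0 ^+ 2).

Definition spectral_norm (R : realType) (m n : nat) (M : 'M[R]_(m, n)) : R :=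
  sup [set norm2 (M *m x) | x in [set x : 'cV[R]_n | norm2 x <= 1]].

Definition frobenius_norm (R : realType) (m n : nat) (M : 'M[R]_(m, n)) : R :=
  Num.sqrt (\sum_i \sum_j M i j ^+ 2).

Definition posdefmx (R : realType) (n : nat) (M : 'M[R]_n) : Prop :=
  M^T = M /\ forall x : 'cV[R]_n, x != 0 -> 0 < (x^T *m M *m x) 0 0.

Definition penrose (R : realType) (m n : nat) (M : 'M[R]_(m, n))
    (X : 'M[R]_(n, m)) : Prop :=
  [/\ M *m X *m M = M, X *m M *m X = X,
      (M *m X)^T = M *m X & (X *m M)^T = X *m M].

Definition mp_inverse (R : realType) (m n : nat) (M : 'M[R]_(m, n)) :
    'M[R]_(n, m) :=
  xget 0 [set X | penrose M X].

Lemma penrose_uniq (R : realType) (m n : nat) (M : 'M[R]_(m, n))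
    (X Y : 'M[R]_(n, m)) :
  penrose M X -> penrose M Y -> X = Y.
Proof.
move=> [MXM XMX MX XM] [MYM YMY MY YM].
have eMX : M *m X = M *m Y.
  rewrite -MX -{1}MYM -(mulmxA (M *m Y)) trmx_mul MX MY mulmxA.
  by rewrite MXM.
have eXM : X *m M = Y *m M.
  rewrite -XM -{1}MYM -(mulmxA M) mulmxA trmx_mul XM YM -mulmxA (mulmxA M).
  by rewrite MXM.
by rewrite -XMX eXM -mulmxA eMX mulmxA YMY.
Qed.

Lemma gram_unitmx (R : realType) (m n : nat) (B : 'M[R]_(m, n)) :
  row_free B -> B *m B^T \in unitmx.
Proof.
move=> Bfree; rewrite -row_free_unit -kermx_eq0; apply/eqP/row_matrixP => i.
rewrite row0; set u := row i _.
have uBB : u *m (B *m B^T) = 0.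
  by apply/sub_kermxP; rewrite row_sub.
have uB0 : u *m B = 0.
  have /matrixP/(_ 0 0) : (u *m B) *m (u *m B)^T = 0.
    by rewrite trmx_mul mulmxA -(mulmxA u) uBB mul0mx.
  rewrite !mxE => /eqP; rewrite psumr_eq0; last first.
    by move=> j _; rewrite [(u *m B)^T _ _]mxE -expr2 sqr_ge0.
  move=> /allP uB0; apply/rowP => j; rewrite [RHS]mxE.
  have := uB0 j (mem_index_enum j); rewrite [(u *m B)^T _ _]mxE -expr2.
  by rewrite sqrf_eq0 => /eqP.
by apply: (row_free_inj Bfree); rewrite uB0 mul0mx.
Qed.

Lemma mp_inverseP (R : realType) (m n : nat) (M : 'M[R]_(m, n)) :
  penrose M (mp_inverse M).
Proof.
suff [X MX] : exists X, penrose M X by exact: (xgetPex 0 (ex_intro _ X MX)).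
have [r [C [B [eM fC fB]]]] : exists r (C : 'M_(m, r)) (B : 'M_(r, n)),
    [/\ M = C *m B, row_free C^T & row_free B].
  exists (\rank M), (col_base M), (row_base M); split.
  - by rewrite mulmx_base.
  - by rewrite /row_free mxrank_tr; exact: col_base_full.
  - exact: row_base_free.
have uB : B *m B^T \in unitmx by exact: gram_unitmx.
have uC : C^T *m C \in unitmx by have := gram_unitmx fC; rewrite trmxK.
pose G := invmx (B *m B^T); pose H := invmx (C^T *m C).
have BG : B *m B^T *m G = 1%:M by exact: mulmxV.
have HC : H *m (C^T *m C) = 1%:M by exact: mulVmx.
have Gt : G^T = G by rewrite /G trmx_inv trmx_mul trmxK.
have Ht : H^T = H by rewrite /H trmx_inv trmx_mul trmxK.
pose X := B^T *m G *m H *m C^T.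
have MX : M *m X = C *m H *m C^T.
  have -> : M *m X = C *m (B *m B^T *m G) *m H *m C^T.
    by rewrite /X eM !mulmxA.
  by rewrite BG mulmx1.
have XM : X *m M = B^T *m G *m B.
  have -> : X *m M = B^T *m G *m (H *m (C^T *m C)) *m B.
    by rewrite /X eM !mulmxA.
  by rewrite HC mulmx1.
exists X; split.
- have -> : M *m X *m M = C *m (H *m (C^T *m C)) *m B.
    by rewrite MX eM !mulmxA.
  by rewrite HC mulmx1.
- have -> : X *m M *m X = B^T *m G *m (B *m B^T *m G) *m H *m C^T.
    by rewrite XM /X !mulmxA.
  by rewrite BG mulmx1.
- by rewrite MX !trmx_mul trmxK Ht mulmxA.
- by rewrite XM !trmx_mul trmxK Gt mulmxA.
Qed.

Definition is_min (R : realType) (E : set R) (x : R) : Prop :=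
  E x /\ lbound E x.

Definition Sigma (R : realType) (p q : nat) : 'M[R]_(p + q) :=
  block_mx 1%:M 0 0 (- 1%:M).
Arguments Sigma {R} p q.

Definition residual (R : realType) (m n : nat) (A : 'M[R]_(m, n))
    (b : 'cV[R]_m) (y : 'cV[R]_n) : 'cV[R]_m :=
  b - A *m y.

Definition xi_ILS (R : realType) (p q n : nat) (A : 'M[R]_(p + q, n))
    (b : 'cV[R]_(p + q)) (y : 'cV[R]_n) :
    set ('M[R]_(p + q, n) * 'cV[R]_(p + q)) :=
  [set D | (A + D.1)^T *m Sigma p q *m (b + D.2 - (A + D.1) *m y) = 0].

Definition perturbation_norms (R : realType) (p q n : nat)
    (A : 'M[R]_(p + q, n)) (b : 'cV[R]_(p + q)) (y : 'cV[R]_n) (theta : R) :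
    set R :=
  [set frobenius_norm (row_mx D.1 (theta *: D.2)) | D in xi_ILS A b y].

(* The casts only identify n * 1 with n and 1 * (p + q) with p + q in the
   dimensions of the Kronecker products. *)
Definition J_ILS (R : realType) (p q n : nat) (A : 'M[R]_(p + q, n))
    (b : 'cV[R]_(p + q)) (y : 'cV[R]_n) (theta : R) :
    'M[R]_(n, n * (p + q) + (p + q)) :=
  row_mx
    (castmx (muln1 n, erefl) (1%:M *t ((residual A b y)^T *m Sigma p q))
     - A^T *m Sigma p q *m castmx (mul1n (p + q), erefl) (y^T *t 1%:M))
    (theta^-1 *: (A^T *m Sigma p q)).

Definition mu_bar (R : realType) (p q n : nat) (A : 'M[R]_(p + q, n))
    (b : 'cV[R]_(p + q)) (y : 'cV[R]_n) (theta : R) : R :=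
  norm2 (mp_inverse (J_ILS A b y theta) *m
         (A^T *m Sigma p q *m residual A b y)).

Definition eta1 (R : realType) (n : nat) (y : 'cV[R]_n) (theta : R) : R :=
  Num.sqrt (theta ^- 2 + norm2 y ^+ 2).

(* Main.v *)
(* Encode a perturbation as the vector z = (vec (Delta A), theta * Delta b), so
   that the Frobenius norm of [Delta A, theta * Delta b] is |z|.  With
   c = A^T Sigma r_y, the condition (Delta A, Delta b) in xi_ILS reads
     c + J z + Q(z) = 0,    Q(z) = (Delta A)^T Sigma (Delta b - (Delta A) y),
   where |Q(z) - Q(w)| <= eta1 (|z| + |w|) |z - w|.  As A^T Sigma A is positive
   definite, A^T Sigma has full row rank, hence J J^+ = 1.
   Upper bound: under the smallness hypothesis z |-> - J^+ (c + Q(z)) maps the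
   ball of radius 2 mu_bar to itself and is a contraction there; its fixed point
   solves the equation.
   Lower bound: applying J^+ to the equation, and using that J^+ J is an
   orthogonal projection, gives mu_bar <= |z| + |J^+| eta1 |z|^2. *)
Require Import Defs.
From mathcomp Require Import all_boot all_order all_algebra.
From mathcomp Require Import all_classical all_reals.
From mathcomp Require Import all_analysis.
From mathcomp Require Import ring lra.

Import Order.TTheory GRing.Theory Num.Theory.
Import numFieldNormedType.Exports.
Local Open Scope classical_set_scope.
Local Open Scope ring_scope.

(** * Euclidean, Frobenius and spectral norms *)

Lemma norm2_ge0 {R : realType} {n} (v : 'cV[R]_n) : 0 <= norm2 v.
Proof. exact: sqrtr_ge0. Qed.

Lemma frobenius_norm_ge0 {R : realType} {m n} (M : 'M[R]_(m, n)) :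
  0 <= frobenius_norm M.
Proof. exact: sqrtr_ge0. Qed.

Lemma sqr_norm2 {R : realType} {n} (v : 'cV[R]_n) :
  norm2 v ^+ 2 = \sum_i v i 0 ^+ 2.
Proof. by rewrite sqr_sqrtr// sumr_ge0// => i _; rewrite sqr_ge0. Qed.

Lemma sqr_frobenius_norm {R : realType} {m n} (M : 'M[R]_(m, n)) :
  frobenius_norm M ^+ 2 = \sum_i \sum_j M i j ^+ 2.
Proof.
rewrite sqr_sqrtr// sumr_ge0// => i _; rewrite sumr_ge0// => j _.
by rewrite sqr_ge0.
Qed.

Lemma mulmx_tr_norm2 {R : realType} {n} (v : 'cV[R]_n) :
  (v^T *m v) 0 0 = norm2 v ^+ 2.
Proof. by rewrite sqr_norm2 mxE; apply: eq_bigr => i _; rewrite mxE expr2. Qed.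

Lemma norm2_eq0 {R : realType} {n} (v : 'cV[R]_n) : norm2 v = 0 -> v = 0.
Proof.
move=> v0; have := sqr_norm2 v; rewrite v0 expr0n /= => /esym/eqP.
rewrite psumr_eq0 => [/allP vi0|i _]; last exact: sqr_ge0.
apply/colP => i; rewrite mxE; apply/eqP.
by have := vi0 i (mem_index_enum i); rewrite sqrf_eq0.
Qed.

Lemma norm20 {R : realType} {n} : norm2 (0 : 'cV[R]_n) = 0.
Proof.
by rewrite /norm2 big1 ?sqrtr0// => i _; rewrite mxE expr0n.
Qed.

Lemma norm2Z {R : realType} {n} (a : R) (v : 'cV[R]_n) :
  norm2 (a *: v) = `|a| * norm2 v.
Proof.
rewrite /norm2 -sqrtr_sqr -sqrtrM ?sqr_ge0// mulr_sumr; congr Num.sqrt.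
by apply: eq_bigr => i _; rewrite mxE exprMn.
Qed.

Lemma norm2N {R : realType} {n} (v : 'cV[R]_n) : norm2 (- v) = norm2 v.
Proof. by rewrite -scaleN1r norm2Z normrN1 mul1r. Qed.

Lemma norm2D_sqr {R : realType} {n} (u v : 'cV[R]_n) :
  norm2 (u + v) ^+ 2 = norm2 u ^+ 2 + 2 * (u^T *m v) 0 0 + norm2 v ^+ 2.
Proof.
rewrite !sqr_norm2 mxE mulr_sumr -!big_split /=; apply: eq_bigr => i _.
by rewrite !mxE; ring.
Qed.

Lemma cauchy_schwarz_norm2 {R : realType} {n} (u v : 'cV[R]_n) :
  (u^T *m v) 0 0 <= norm2 u * norm2 v.
Proof.
have [u0|u_neq0] := eqVneq (norm2 u) 0.
  by rewrite (norm2_eq0 u u0) trmx0 mul0mx norm20 mul0r mxE.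
have [v0|v_neq0] := eqVneq (norm2 v) 0.
  by rewrite (norm2_eq0 v v0) mulmx0 norm20 mulr0 mxE.
have u_gt0 : 0 < norm2 u by rewrite lt_def u_neq0 norm2_ge0.
have v_gt0 : 0 < norm2 v by rewrite lt_def v_neq0 norm2_ge0.
(* The squared norm of |v| u - |u| v expands to 2 |u| |v| (|u| |v| - u^T v). *)
have := sqr_ge0 (norm2 (norm2 v *: u + - norm2 u *: v)).
rewrite norm2D_sqr !norm2Z normrN !ger0_norm ?norm2_ge0//.
have -> : ((norm2 v *: u)^T *m (- norm2 u *: v)) 0 0 =
    - (norm2 u * norm2 v) * (u^T *m v) 0 0.
  by rewrite !mxE mulr_sumr; apply: eq_bigr => i _; rewrite !mxE; ring.
set s := (_ *m _) 0 0 => h.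
have {h} : 0 <= (norm2 u * norm2 v) * (norm2 u * norm2 v - s) by nra.
by rewrite pmulr_rge0 ?mulr_gt0// subr_ge0.
Qed.

Lemma ler_norm2D {R : realType} {n} (u v : 'cV[R]_n) :
  norm2 (u + v) <= norm2 u + norm2 v.
Proof.
rewrite -ler_sqr ?nnegrE ?addr_ge0 ?norm2_ge0// norm2D_sqr sqrrD.
rewrite lerD2r lerD2l -[leRHS]mulr_natl.
by rewrite ler_wpM2l// cauchy_schwarz_norm2.
Qed.

Lemma norm2_mulmx {R : realType} {m n} (M : 'M[R]_(m, n)) (v : 'cV[R]_n) :
  norm2 (M *m v) <= frobenius_norm M * norm2 v.
Proof.
rewrite -ler_sqr ?nnegrE ?mulr_ge0 ?norm2_ge0 ?frobenius_norm_ge0//.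
rewrite exprMn sqr_frobenius_norm sqr_norm2 mulr_suml.
apply: ler_sum => i _.
have rowi : norm2 (row i M)^T ^+ 2 = \sum_j M i j ^+ 2.
  by rewrite sqr_norm2; apply: eq_bigr => j _; rewrite !mxE.
have Mvi w : (M *m w) i 0 = ((row i M)^T^T *m w) 0 0.
  by rewrite trmxK -row_mul [RHS]mxE.
rewrite -rowi -exprMn -ler_sqrt ?sqr_ge0// !sqrtr_sqr.
rewrite [leRHS]ger0_norm ?mulr_ge0 ?norm2_ge0// ler_norml.
(* The two signs of the absolute value are Cauchy-Schwarz for [- v] and for [v]. *)
rewrite lerNl -[in X in X && _](norm2N v) -[- (M *m v) i 0]mulN1r.
have -> : -1 * (M *m v) i 0 = (M *m (- v)) i 0.
  by rewrite mulmxN mulN1r [RHS]mxE.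
by rewrite !Mvi !cauchy_schwarz_norm2.
Qed.

Lemma frobenius_norm_tr {R : realType} {m n} (M : 'M[R]_(m, n)) :
  frobenius_norm M^T = frobenius_norm M.
Proof.
rewrite /frobenius_norm exchange_big; congr Num.sqrt.
by apply: eq_bigr => i _; apply: eq_bigr => j _; rewrite mxE.
Qed.

(** The Frobenius norm bounds the set under [sup], so the supremum is a genuine upper bound. *)
Lemma spectral_norm_ge {R : realType} {m n} (M : 'M[R]_(m, n)) (v : 'cV[R]_n) :
  norm2 v <= 1 -> norm2 (M *m v) <= spectral_norm M.
Proof.
move=> v1; apply: ub_le_sup; last by exists v.
exists (frobenius_norm M) => _ [x x1 <-].
by rewrite (le_trans (norm2_mulmx M x))// ler_piMr ?frobenius_norm_ge0.
Qed.

Lemma spectral_norm_ge0 {R : realType} {m n} (M : 'M[R]_(m, n)) :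
  0 <= spectral_norm M.
Proof.
by rewrite (le_trans _ (spectral_norm_ge M 0 _)) ?norm2_ge0// norm20.
Qed.

Lemma norm2_mulmx_spectral {R : realType} {m n} (M : 'M[R]_(m, n))
    (v : 'cV[R]_n) :
  norm2 (M *m v) <= spectral_norm M * norm2 v.
Proof.
have [v0|v_neq0] := eqVneq (norm2 v) 0.
  by rewrite (norm2_eq0 v v0) mulmx0 !norm20 mulr0.
have v_gt0 : 0 < norm2 v by rewrite lt_def v_neq0 norm2_ge0.
have := spectral_norm_ge M ((norm2 v)^-1 *: v).
rewrite -scalemxAr !norm2Z ger0_norm ?invr_ge0 ?norm2_ge0// mulVf//.
by move/(_ (lexx _)); rewrite mulrC ler_pdivrMr.
Qed.

(** Symmetry and idempotence give |P v|^2 = (P v)^T v, which Cauchy-Schwarz bounds by |P v| |v|. *)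
Lemma norm2_orthogonal_projection {R : realType} {n} (P : 'M[R]_n)
    (v : 'cV[R]_n) :
  P^T = P -> P *m P = P -> norm2 (P *m v) <= norm2 v.
Proof.
move=> Pt PP; have [->|Pv_neq0] := eqVneq (norm2 (P *m v)) 0.
  exact: norm2_ge0.
have Pv_gt0 : 0 < norm2 (P *m v) by rewrite lt_def Pv_neq0 norm2_ge0.
rewrite -(ler_pM2l Pv_gt0) -expr2 -mulmx_tr_norm2.
have -> : (P *m v)^T *m (P *m v) = (P *m v)^T *m v.
  by rewrite trmx_mul Pt mulmxA -(mulmxA v^T) PP.
exact: cauchy_schwarz_norm2.
Qed.

(** * Entrywise continuity and minima over Euclidean balls *)

Section EntrywiseContinuity.
Context {R : realType} {T : topologicalType}.

(** Stated entry by entry, so that sums and products of matrices reduce to real-valued functions. *)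
Definition mx_continuous {m n} (F : T -> 'M[R]_(m, n)) :=
  forall i j, continuous (fun t => F t i j).

Lemma mx_continuous_cst {m n} (M : 'M[R]_(m, n)) :
  mx_continuous (fun _ => M).
Proof. by move=> i j; exact: cst_continuous. Qed.

Lemma mx_continuousD {m n} (F G : T -> 'M[R]_(m, n)) :
  mx_continuous F -> mx_continuous G -> mx_continuous (fun t => F t + G t).
Proof.
move=> cF cG i j t; under eq_fun do rewrite mxE.
by apply: continuousD; [exact: cF|exact: cG].
Qed.

Lemma mx_continuousN {m n} (F : T -> 'M[R]_(m, n)) :
  mx_continuous F -> mx_continuous (fun t => - F t).
Proof.
move=> cF i j t; under eq_fun do rewrite mxE.
by apply: continuousN; exact: cF.
Qed.

Lemma mx_continuousB {m n} (F G : T -> 'M[R]_(m, n)) :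
  mx_continuous F -> mx_continuous G -> mx_continuous (fun t => F t - G t).
Proof. by move=> cF cG; apply: mx_continuousD => //; exact: mx_continuousN. Qed.

Lemma mx_continuous_tr {m n} (F : T -> 'M[R]_(m, n)) :
  mx_continuous F -> mx_continuous (fun t => (F t)^T).
Proof.
by move=> cF i j t; under eq_fun do rewrite mxE; exact: cF.
Qed.

Lemma continuous_sumr {I} (r : seq I) (f : I -> T -> R) :
  (forall i, continuous (f i)) -> continuous (fun t => \sum_(i <- r) f i t).
Proof.
move=> cf t; elim: r => [|i r IHr].
  under eq_fun do rewrite big_nil; exact: cst_continuous.
under eq_fun do rewrite big_cons.
by apply: continuousD => //; exact: cf.
Qed.

Lemma mx_continuousM {m n p} (F : T -> 'M[R]_(m, n)) (G : T -> 'M[R]_(n, p)) :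
  mx_continuous F -> mx_continuous G -> mx_continuous (fun t => F t *m G t).
Proof.
move=> cF cG i j; under eq_fun do rewrite mxE.
by apply: continuous_sumr => k t; apply: continuousM; [exact: cF|exact: cG].
Qed.

Lemma mx_continuous_norm2 {n} (F : T -> 'cV[R]_n) :
  mx_continuous F -> continuous (fun t => norm2 (F t)).
Proof.
move=> cF t.
apply: (@continuous_comp _ _ _ (fun t => \sum_i F t i 0 ^+ 2) Num.sqrt);
  last exact: sqrt_continuous.
apply: continuous_sumr => i {}t; under eq_fun do rewrite expr2.
by apply: continuousM; exact: cF.
Qed.

End EntrywiseContinuity.

(** The part of the ball where [G] vanishes is compact and contains [z], so the extreme value
    theorem applies; row vectors appear because that theorem is used for ['rV]. It serves twice: to
    find a fixed point, and to select a solution of least norm. *)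
Lemma norm2_min_on_ball {R : realType} {n k l} (F : 'cV[R]_n -> 'cV[R]_k)
    (G : 'cV[R]_n -> 'cV[R]_l) (rho : R) (z : 'cV[R]_n) :
  mx_continuous (fun v : 'rV[R]_n => F v^T) ->
  mx_continuous (fun v : 'rV[R]_n => G v^T) ->
  norm2 z <= rho -> G z = 0 ->
  exists z0, [/\ norm2 z0 <= rho, G z0 = 0 &
    forall w, norm2 w <= rho -> G w = 0 -> norm2 (F z0) <= norm2 (F w)].
Proof.
move=> cF cG z_rho Gz0.
pose K := [set v : 'rV[R]_n | norm2 v^T <= rho /\ norm2 (G v^T) = 0].
have ctr : mx_continuous (fun v : 'rV[R]_n => v^T).
  by move=> i j; under eq_fun do rewrite mxE; exact: coord_continuous.
have K_compact : compact K.
  apply: bounded_closed_compact.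
    exists rho; split; first by rewrite num_real.
    (* Boundedness refers to the max norm, whose entries the Euclidean norm dominates; [0 <= rho]
       handles the initial value 0 of the maximum. *)
    move=> M rhoM v [v_rho _]; change (mx_norm v <= M); rewrite mx_normrE.
    have rho0 : 0 <= rho by rewrite (le_trans (norm2_ge0 v^T)).
    apply/bigmax_leP; split=> [|[i j] _ /=]; first lra.
    apply: (le_trans _ (ltW rhoM)); apply: le_trans v_rho.
    rewrite -sqrtr_sqr ler_sqrt ?sumr_ge0// => [|a _]; last exact: sqr_ge0.
    rewrite ord1 (bigD1 j) //= mxE lerDl sumr_ge0// => a _.
    exact: sqr_ge0.
  have -> : K = [set v | norm2 v^T <= rho] `&` [set v | norm2 (G v^T) = 0].
    by [].
  apply: closedI.
    apply: (@closed_comp _ _ (fun v : 'rV[R]_n => norm2 v^T)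
      [set x | x <= rho]).
      by move=> v _; exact: mx_continuous_norm2.
    exact: closed_le.
  apply: (@closed_comp _ _ (fun v : 'rV[R]_n => norm2 (G v^T)) [set x | x = 0]).
    by move=> v _; exact: mx_continuous_norm2.
  exact: closed_eq.
have [||v Kv v_min] := @EVT_min_rV R n (fun v => norm2 (F v^T)) K _ K_compact.
- by exists z^T; rewrite /K /= trmxK z_rho Gz0 norm20.
- by apply: continuous_subspaceT; exact: mx_continuous_norm2.
move: Kv; rewrite inE => -[v_rho Gv].
exists v^T; split=> //; first exact: norm2_eq0.
move=> w w_rho Gw; have := v_min w^T; rewrite trmxK; apply.
by rewrite inE /K /= trmxK w_rho Gw norm20.
Qed.

(** * Linear equations with a quadratic perturbation *)

Lemma linear_quadratic_lower_bound {R : rcfType} (a m t : R) :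
  0 <= m -> 0 <= t -> 4 * (a * m) < 1 -> m <= t + a * t ^+ 2 ->
  2 / (1 + Num.sqrt 2) * m <= t.
Proof.
move=> m_ge0 t_ge0 small m_le.
have s_sqr : Num.sqrt 2 ^+ 2 = 2 :> R by rewrite sqr_sqrtr.
have s_ge0 : 0 <= Num.sqrt 2 :> R by exact: sqrtr_ge0.
move: (Num.sqrt 2) s_sqr s_ge0 => s s_sqr s_ge0.
have s1_gt0 : 0 < 1 + s by rewrite ltr_pwDl.
(* Multiplying the hypothesis by 4m and using 4am < 1 gives 4m^2 <= 4mt + t^2, that is 8m^2 <= (t +
   2m)^2. Taking roots, t >= 2 (sqrt 2 - 1) m, and sqrt 2 - 1 = 1 / (1 + sqrt 2). *)
have amt : 4 * (a * m) * t ^+ 2 <= t ^+ 2 by rewrite ler_piMl ?sqr_ge0// ltW.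
have mm : 4 * m * m <= 4 * m * (t + a * t ^+ 2) by rewrite ler_wpM2l ?mulr_ge0.
have root : 2 * s * m <= t + 2 * m.
  rewrite -ler_sqr ?nnegrE ?addr_ge0 ?mulr_ge0//.
  have -> : (2 * s * m) ^+ 2 = 8 * m * m by rewrite !exprMn s_sqr; ring.
  by nra.
rewrite mulrAC ler_pdivrMr//.
have {root} : (2 * s * m) * (1 + s) <= (t + 2 * m) * (1 + s).
  by rewrite ler_wpM2r// ltW.
have -> : 2 * s * m * (1 + s) = 2 * s * m + 2 * m * s ^+ 2 by ring.
by rewrite s_sqr; lra.
Qed.

(** Isolates what the argument needs of the ILS equation: [X] is both the Moore-Penrose inverse and
    a right inverse of [J], and [Q] satisfies the Lipschitz estimate of a quadratic map. *)
Lemma quadratic_perturbation {R : realType} {k n} (J : 'M[R]_(k, n))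
    (X : 'M[R]_(n, k)) (c : 'cV[R]_k) (Q : 'cV[R]_n -> 'cV[R]_k) (eta : R) :
  penrose J X -> J *m X = 1%:M -> 0 <= eta ->
  mx_continuous (fun v : 'rV[R]_n => Q v^T) -> Q 0 = 0 ->
  (forall z w, norm2 (Q z - Q w) <=
     eta * (norm2 z + norm2 w) * norm2 (z - w)) ->
  4 * eta * spectral_norm X * norm2 (X *m c) < 1 ->
  exists z0, [/\ c + J *m z0 + Q z0 = 0,
    (forall z, c + J *m z + Q z = 0 -> norm2 z0 <= norm2 z),
    2 / (1 + Num.sqrt 2) * norm2 (X *m c) <= norm2 z0 &
    norm2 z0 <= 2 * norm2 (X *m c)].
Proof.
move=> [_ XJX _ XJt] JX eta_ge0 cQ Q0 Qlip.
set sigma := spectral_norm X; set mb := norm2 (X *m c) => small.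
have sigma_ge0 : 0 <= sigma by exact: spectral_norm_ge0.
have mb_ge0 : 0 <= mb by exact: norm2_ge0.
have cid : mx_continuous (fun v : 'rV[R]_n => v^T).
  by move=> i j; under eq_fun do rewrite mxE; exact: coord_continuous.
have Qsqr z : norm2 (Q z) <= eta * norm2 z ^+ 2.
  by have := Qlip z 0; rewrite Q0 norm20 !subr0 addr0 -mulrA -expr2.
pose T z := - (X *m (c + Q z)).
have T_ball z : norm2 z <= 2 * mb -> norm2 (T z) <= 2 * mb.
  move=> z_le; rewrite norm2N mulmxDr (le_trans (ler_norm2D _ _))//.
  rewrite mulr_natl mulr2n lerD2l.
  apply: (le_trans (norm2_mulmx_spectral _ _)); rewrite -/sigma.
  apply: (@le_trans _ _ (sigma * (eta * (2 * mb) ^+ 2))).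
    rewrite ler_wpM2l// (le_trans (Qsqr z))// ler_wpM2l//.
    by rewrite ler_sqr ?nnegrE ?norm2_ge0 ?mulr_ge0.
  (* On the ball of radius [2 * mb] the quadratic term is at most [mb] times the quantity that
     [small] bounds by 1. *)
  have -> : sigma * (eta * (2 * mb) ^+ 2) = 4 * eta * sigma * mb * mb by ring.
  by rewrite ler_piMl// ltW.
have T_contraction z w : norm2 z <= 2 * mb -> norm2 w <= 2 * mb ->
    norm2 (T z - T w) <= 4 * eta * sigma * mb * norm2 (z - w).
  move=> z_le w_le.
  have -> : T z - T w = - (X *m (Q z - Q w)).
    rewrite /T opprK addrC -mulmxBr -mulmxN opprB.
    by rewrite opprD addrACA subrr add0r.
  rewrite norm2N (le_trans (norm2_mulmx_spectral _ _))// -/sigma.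
  (* In the ball |z| + |w| <= 4 mb, so the contraction factor is again the quantity in [small]. *)
  apply: (@le_trans _ _ (sigma * (eta * (4 * mb) * norm2 (z - w)))).
    rewrite ler_wpM2l// (le_trans (Qlip z w))// ler_wpM2r ?norm2_ge0//.
    by rewrite ler_wpM2l//; lra.
  by rewrite le_eqVlt; apply/orP; left; apply/eqP; ring.
have [z1 [z1_le z1_sol]] : exists z1, norm2 z1 <= 2 * mb /\
    c + J *m z1 + Q z1 = 0.
  (* The fixed point of the contraction [T] is obtained by minimising
     [norm2 (z - T z)] over the compact ball. *)
  have [||||z1 [z1_le _ z1_min]] := @norm2_min_on_ball R n n 0
      (fun z => z - T z) (fun=> 0) (2 * mb) 0.
  - apply: mx_continuousB => //; apply: mx_continuousN.
    apply: mx_continuousM; first exact: mx_continuous_cst.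
    by apply: mx_continuousD => //; exact: mx_continuous_cst.
  - exact: mx_continuous_cst.
  - by rewrite norm20 mulr_ge0.
  - by [].
  have z1_fix : z1 = T z1.
    apply/eqP; rewrite -subr_eq0; apply/eqP/norm2_eq0.
    (* Comparing [z1] with [T z1] gives d <= |T z1 - T (T z1)| <= kappa d with kappa < 1, hence d =
       0. *)
    have := z1_min _ (T_ball _ z1_le) erefl.
    move=> /le_trans/(_ (T_contraction _ _ z1_le (T_ball _ z1_le))).
    have := norm2_ge0 (z1 - T z1).
    set d := norm2 _; set kappa := 4 * _ * _ * _ in small *.
    by nra.
  exists z1; split=> //; rewrite {1}z1_fix /T mulmxN mulmxA JX mul1mx.
  by rewrite addrAC subrr.
(* Least-norm solution in the ball, where [z1] shows that one exists. It is least among all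
   solutions, since those outside the ball have norm above [2 * mb]. *)
have [||||z0 [z0_le z0_sol z0_min]] := @norm2_min_on_ball R n n k
    id (fun z => c + J *m z + Q z) (2 * mb) z1 => //.
  apply: mx_continuousD => //; apply: mx_continuousD.
    exact: mx_continuous_cst.
  by apply: mx_continuousM => //; exact: mx_continuous_cst.
exists z0; split=> //.
  move=> z z_sol; have [z_le|/ltW z_ge] := leP (norm2 z) (2 * mb).
    exact: z0_min.
  exact: le_trans z_ge.
have mb_le : mb <= norm2 z0 + sigma * (eta * norm2 z0 ^+ 2).
  have -> : mb = norm2 (X *m J *m z0 + X *m Q z0).
    rewrite -(norm2N (_ + _)) /mb; congr norm2.
    apply/eqP; rewrite -subr_eq0 opprK addrA -mulmxA -!mulmxDr.
    by rewrite z0_sol mulmx0.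
  rewrite (le_trans (ler_norm2D _ _))// lerD//.
    apply: norm2_orthogonal_projection => //.
    by rewrite mulmxA XJX.
  by rewrite (le_trans (norm2_mulmx_spectral _ _))// ler_wpM2l.
apply: (@linear_quadratic_lower_bound R (sigma * eta)) => //.
- exact: norm2_ge0.
- by move: small; rewrite mulrA (mulrC sigma) mulrA.
- by rewrite -mulrA.
Qed.

(** * Perturbations encoded as vectors *)

Lemma big_mxtens_index {R : nmodType} m n (F : 'I_(m * n) -> R) :
  \sum_k F k = \sum_i \sum_j F (mxtens_index (i, j)).
Proof.
rewrite pair_bigA /=.
rewrite (reindex (@mxtens_index m n)) /=; first by apply: eq_bigr => -[].
exists (@mxtens_unindex m n) => k _; first exact: mxtens_indexK.
exact: mxtens_unindexK.
Qed.

(* [vec_pert] encodes the perturbation [Delta A, theta * Delta b] as the column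
   vector on which [J_ILS] acts; [pertA] and [pertb] decode it. *)
Definition vec_pert {R : realType} {m n} (theta : R)
    (D : 'M[R]_(m, n) * 'cV[R]_m) : 'cV[R]_(n * m + m) :=
  col_mx (\col_k D.1 (mxtens_unindex k).2 (mxtens_unindex k).1)
    (theta *: D.2).

Definition pertA {R : realType} {m n} (z : 'cV[R]_(n * m + m)) : 'M[R]_(m, n) :=
  \matrix_(i, j) usubmx z (mxtens_index (j, i)) 0.

Definition pertb {R : realType} {m n} (theta : R) (z : 'cV[R]_(n * m + m)) :
    'cV[R]_m :=
  theta^-1 *: dsubmx z.

Section Perturbations.
Context {R : realType} {m n : nat} (theta : R).
Implicit Types (z w : 'cV[R]_(n * m + m)) (D : 'M[R]_(m, n) * 'cV[R]_m).

Lemma vec_pertK D : theta != 0 ->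
  pertA (vec_pert theta D) = D.1 /\ pertb theta (vec_pert theta D) = D.2.
Proof.
move=> theta0; split; last by rewrite /pertb col_mxKd scalerA mulVf ?scale1r.
by apply/matrixP => i j; rewrite mxE col_mxKu mxE mxtens_indexK.
Qed.

Lemma pertK z : theta != 0 -> vec_pert theta (pertA z, pertb theta z) = z.
Proof.
move=> theta0; rewrite -[RHS]vsubmxK /vec_pert; congr col_mx.
  apply/colP => k; case: (mxtens_indexP k) => i j.
  by rewrite !mxE mxtens_indexK.
by rewrite /pertb scalerA divff ?scale1r.
Qed.

Lemma norm2_vec_pert D :
  norm2 (vec_pert theta D) = frobenius_norm (row_mx D.1 (theta *: D.2)).
Proof.
rewrite /norm2 /frobenius_norm; congr Num.sqrt.
rewrite big_split_ord /= big_mxtens_index exchange_big -big_split /=.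
apply: eq_bigr => i _; rewrite big_split_ord /= big_ord1 row_mxEr col_mxEd.
congr (_ + _); apply: eq_bigr => j _.
by rewrite row_mxEl col_mxEu mxE mxtens_indexK.
Qed.

Lemma pertAB z w : pertA (z - w) = pertA z - pertA w.
Proof. by apply/matrixP => i j; rewrite !mxE. Qed.

Lemma pertbB z w : pertb theta (z - w) = pertb theta z - pertb theta w.
Proof. by rewrite /pertb linearB scalerBr. Qed.

(** The left vector is [Delta A, theta Delta b] applied to the column (-y, 1/theta), whose Euclidean
    norm is [eta1 y theta]. *)
Lemma norm2_pert_residual z (y : 'cV[R]_n) : theta != 0 ->
  norm2 (pertb theta z - pertA z *m y) <= eta1 y theta * norm2 z.
Proof.
move=> theta0; rewrite -{3}(pertK z theta0) norm2_vec_pert /=.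
have -> : pertb theta z - pertA z *m y =
    row_mx (pertA z) (theta *: pertb theta z) *m
    col_mx (- y) (theta^-1)%:M.
  rewrite mul_row_col mulmxN mul_mx_scalar scalerA mulVf// scale1r.
  by rewrite addrC.
apply: (le_trans (norm2_mulmx _ _)); rewrite mulrC.
rewrite ler_wpM2r ?frobenius_norm_ge0// /eta1.
rewrite sqr_norm2 {1}/norm2 big_split_ord /= big_ord1 addrC col_mxEd.
rewrite !mxE mulr1n exprVn.
by under eq_bigr do rewrite col_mxEu mxE sqrrN.
Qed.

End Perturbations.

Lemma frobenius_norm_pertA {R : realType} {m n} (z : 'cV[R]_(n * m + m)) :
  frobenius_norm (pertA z) <= norm2 z.
Proof.
(* [pertA] does not involve theta; 1 is an arbitrary nonzero choice. *)
rewrite -{2}(pertK 1 z) ?oner_neq0// norm2_vec_pert /=.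
rewrite ler_sqrt ?sumr_ge0// => [|i _]; last first.
  by rewrite sumr_ge0// => j _; exact: sqr_ge0.
apply: ler_sum => i _; rewrite big_split_ord /= big_ord1 row_mxEr.
under [X in _ <= X + _]eq_bigr do rewrite row_mxEl.
by rewrite lerDl sqr_ge0.
Qed.

(** * Kronecker products and the matrix [J_ILS] *)

Lemma castmx_tens1mx_row {R : pzRingType} {m n} (w : 'rV[R]_m) i j k :
  castmx (muln1 n, erefl) (1%:M *t w) i (mxtens_index (j, k)) =
  w 0 k *+ (i == j).
Proof.
(* Under the cast from [n * 1] to [n], row [i] carries the index pair [(i, 0)]. *)
rewrite castmxE cast_ord_id (_ : cast_ord _ i = mxtens_index (i, 0)).
  by rewrite tensmxE mxE mulr_natl.
by apply/val_inj; rewrite /= muln1 addn0.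
Qed.

Lemma castmx_row_tens1mx {R : pzRingType} {m n} (w : 'rV[R]_n) i j k :
  castmx (mul1n m, erefl) (w *t 1%:M) i (mxtens_index (j, k)) =
  w 0 j *+ (i == k).
Proof.
rewrite castmxE cast_ord_id (_ : cast_ord _ i = mxtens_index (0, i)).
  by rewrite tensmxE mxE mulr_natr.
by apply/val_inj; rewrite /= mul0n add0n.
Qed.

Lemma trmx_Sigma {R : realType} p q :
  (Sigma p q)^T = Sigma p q :> 'M[R]_(p + q).
Proof. by rewrite tr_block_mx !trmx0 linearN /= !trmx1. Qed.

(** [Sigma] only flips signs of coordinates; this removes it from the estimate of the quadratic
    term. *)
Lemma norm2_Sigma {R : realType} p q (v : 'cV[R]_(p + q)) :
  norm2 (Sigma p q *m v) = norm2 v.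
Proof.
rewrite /norm2 -(vsubmxK v) mul_block_col !mul0mx mul1mx mulNmx mul1mx.
rewrite addr0 add0r !big_split_ord; congr (Num.sqrt (_ + _)).
  by apply: eq_bigr => i _; rewrite !col_mxEu.
by apply: eq_bigr => i _; rewrite !col_mxEd mxE sqrrN.
Qed.

(** Column indices come first in the encoding, so I_n (x) r^T Sigma sends vec (Delta A) to (Delta
    A)^T Sigma r, and y^T (x) I_m sends it to (Delta A) y. *)
Lemma J_ILS_mul {R : realType} {p q n} (A : 'M[R]_(p + q, n))
    (b : 'cV[R]_(p + q)) (y : 'cV[R]_n) (theta : R)
    (z : 'cV[R]_(n * (p + q) + (p + q))) :
  J_ILS A b y theta *m z =
    (pertA z)^T *m Sigma p q *m residual A b y
    + A^T *m Sigma p q *m (pertb theta z - pertA z *m y).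
Proof.
rewrite -{1}(vsubmxK z) mul_row_col mulmxBl -!addrA; congr (_ + _).
  apply/colP => i; rewrite mxE big_mxtens_index.
  rewrite (bigD1 i) //= [X in _ + X]big1 ?addr0 => [|j jNi]; last first.
    apply: big1 => k _; rewrite castmx_tens1mx_row eq_sym (negbTE jNi).
    by rewrite mulr0n mul0r.
  rewrite -mulmxA -(trmxK (Sigma p q *m _)) trmx_mul trmx_Sigma mxE.
  apply: eq_bigr => k _; rewrite castmx_tens1mx_row eqxx mulr1n mulrC.
  by congr (_ * _); rewrite [RHS]mxE // [RHS]mxE.
rewrite mulmxBr addrC /pertb -scalemxAr -scalemxAl; congr (_ - _).
rewrite -(mulmxA (A^T *m Sigma p q)); congr (_ *m _).
apply/colP => i; rewrite !mxE big_mxtens_index.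
apply: eq_bigr => j _; rewrite (bigD1 i) //= big1 ?addr0 => [|k kNi].
  by rewrite castmx_row_tens1mx eqxx mulr1n !mxE mulrC.
by rewrite castmx_row_tens1mx eq_sym (negbTE kNi) mulr0n mul0r.
Qed.

(** A nonzero row [u] of the kernel would give u M u^T = 0, against positivity. *)
Lemma posdefmx_unit {R : realType} {n} (M : 'M[R]_n) :
  posdefmx M -> M \in unitmx.
Proof.
move=> [_ Mpos]; rewrite -row_free_unit -kermx_eq0; apply/eqP/row_matrixP => i.
rewrite row0; apply/eqP/negPn/negP => u_neq0.
have uM : row i (kermx M) *m M = 0 by apply/sub_kermxP; rewrite row_sub.
have := Mpos (row i (kermx M))^T.
rewrite trmxK uM mul0mx mxE ltxx => /(_ _)/negP.
by rewrite trmx_eq0 => /(_ u_neq0).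
Qed.

Lemma J_ILS_mp_inverse {R : realType} {p q n} (A : 'M[R]_(p + q, n))
    (b : 'cV[R]_(p + q)) (y : 'cV[R]_n) (theta : R) :
  theta != 0 -> posdefmx (A^T *m Sigma p q *m A) ->
  J_ILS A b y theta *m mp_inverse (J_ILS A b y theta) = 1%:M.
Proof.
move=> theta0 /posdefmx_unit AuA; set J := J_ILS _ _ _ _.
(* An explicit right inverse of [J], built from its last block alone; then J J^+ = J J^+ J Y = J Y =
   1. *)
pose Y := col_mx (0 : 'M[R]_(n * (p + q), n))
  (theta *: (A *m invmx (A^T *m Sigma p q *m A))).
have JY : J *m Y = 1%:M.
  rewrite mul_row_col mulmx0 add0r -scalemxAr -scalemxAl scalerA divff//.
  by rewrite scale1r mulmxA mulmxV.
have [JXJ _ _ _] := mp_inverseP J.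
by rewrite -[LHS]mulmx1 -{1}JY mulmxA JXJ JY.
Qed.

(** * Transfer to the backward error *)

Theorem theorem1 (R : realType) (p q n : nat) (hmn : (n <= p + q)%N)
    (A : 'M[R]_(p + q, n)) (b : 'cV[R]_(p + q))
    (hA : posdefmx (A^T *m Sigma p q *m A))
    (y : 'cV[R]_n) (theta : R) (htheta : 0 < theta)
    (hsmall : 4 * eta1 y theta * spectral_norm (mp_inverse (J_ILS A b y theta))
                * mu_bar A b y theta < 1) :
  exists mu : R,
    [/\ is_min (perturbation_norms A b y theta) mu,
        2 / (1 + Num.sqrt 2) * mu_bar A b y theta <= mu
      & mu <= 2 * mu_bar A b y theta].
Proof.
have theta0 : theta != 0 by rewrite gt_eqF.
set J := J_ILS A b y theta in hsmall *.
pose S : 'M[R]_(p + q) := Sigma p q; pose r := residual A b y.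
pose u (z : 'cV_(n * (p + q) + (p + q))) := pertb theta z - pertA z *m y.
pose Q (z : 'cV_(n * (p + q) + (p + q))) := (pertA z)^T *m S *m u z.
(* The perturbed residual is r + u(z). Expanding (A + Delta A)^T S (r + u(z)) by degree in [z] gives
   the constant term, the linear part [J *m z] and the quadratic part [Q z]. *)
have xiE z : xi_ILS A b y (pertA z, pertb theta z) <->
    A^T *m S *m r + J *m z + Q z = 0.
  rewrite /xi_ILS /= /J J_ILS_mul.
  have -> : b + pertb theta z - (A + pertA z) *m y = r + u z.
    by rewrite /r /residual /u mulmxDl opprD addrACA.
  rewrite -/S -/(u z) -/r /Q; move: (u z) => v; clearbody r.
  by rewrite [(A + _)^T]linearD /= !mulmxDl !mulmxDr addrACA !addrA.
have cpertA : mx_continuous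
    (fun v : 'rV[R]_(n * (p + q) + (p + q)) => pertA v^T).
  by move=> i j; under eq_fun do rewrite !mxE; exact: coord_continuous.
have cpertb : mx_continuous
    (fun v : 'rV[R]_(n * (p + q) + (p + q)) => pertb theta v^T).
  move=> i j v; under eq_fun do rewrite !mxE.
  apply: (@continuousM _ _ (fun=> theta^-1) (fun w : 'rV[R]_(_ + _) => w j _)).
    exact: cst_continuous.
  exact: coord_continuous.
have uB z w : u z - u w = u (z - w).
  by rewrite /u pertAB pertbB mulmxBl !opprD !opprK addrACA.
have [|||||||z0 [z0_sol z0_min z0_lower z0_upper]] :=
    @quadratic_perturbation R _ _ J (mp_inverse J) (A^T *m S *m r) Q
      (eta1 y theta).
- exact: mp_inverseP.
- exact: J_ILS_mp_inverse.
- exact: sqrtr_ge0.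
- apply: mx_continuousM.
    apply: mx_continuousM; last exact: mx_continuous_cst.
    exact: mx_continuous_tr.
  apply: mx_continuousB => //.
  by apply: mx_continuousM => //; exact: mx_continuous_cst.
- have -> : Q 0 = (pertA 0)^T *m S *m u 0 by [].
  by rewrite -{1}(subrr 0) pertAB subrr trmx0 !mul0mx.
- move=> z w.
  (* [Q] is the diagonal of a bilinear map, so the difference telescopes into two terms, each with
     one factor in [z - w]. *)
  have -> : Q z - Q w = (pertA (z - w))^T *m (S *m u z)
      + (pertA w)^T *m (S *m u (z - w)).
    rewrite -uB pertAB /Q; move: (u z) (u w) => v v'.
    by rewrite [(_ - _)^T]linearB /= mulmxBl !mulmxBr !mulmxA addrA subrK.
  have norm_prod (v v' : 'cV[R]_(n * (p + q) + (p + q))) :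
      norm2 ((pertA v)^T *m (S *m u v')) <= norm2 v * (eta1 y theta * norm2 v').
    rewrite (le_trans (norm2_mulmx _ _))// frobenius_norm_tr norm2_Sigma.
    apply: ler_pM; [exact: frobenius_norm_ge0|exact: norm2_ge0| |].
      exact: frobenius_norm_pertA.
    exact: norm2_pert_residual theta0.
  rewrite (le_trans (ler_norm2D _ _))//.
  apply: (le_trans (lerD (norm_prod (z - w) z) (norm_prod w (z - w)))).
  by rewrite le_eqVlt; apply/orP; left; apply/eqP; ring.
- exact: hsmall.
(* The encoding is a norm-preserving bijection: decoding [z0] attains the minimum, and encoding any
   member of [xi_ILS] gives a solution no shorter than [z0]. *)
exists (norm2 z0); split=> //; split.
  exists (pertA z0, pertb theta z0); first exact/xiE.
  by rewrite -norm2_vec_pert pertK.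
move=> _ [D D_xi <-]; rewrite -norm2_vec_pert; apply: z0_min.
apply/xiE; have [-> ->] := vec_pertK theta D theta0.
by case: D D_xi.
Qed.
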